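(* Let $\mathbb{K}\in\{\mathbb{R},\mathbb{C}\}$. Let $\{\bm{\varphi}_x\}_{x\in\Omega}$ be a family of vectors in $\mathbb{K}^n$, without any specific assumptions on the index set $\Omega$, and let $\bm{\varphi}:\Omega\to\mathbb{K}^n$ be the function $x\mapsto\bm{\varphi}_x$. The following assertions are equivalent. (i) $\bm{I}_n\in\operatorname{cone}\{\bm{\varphi}_x\bm{\varphi}_x^\ast: x\in\Omega\}$. (ii) There exists a positive measure $\mu$ on $\Omega$ such that $\bm{\varphi}\in L_2(\Omega,\mu;\mathbb{K}^n)$ and $\bm{\varphi}$ is a Parseval $\mu$-frame for $\mathbb{K}^n$. (iii) There exist $N\le\dim_{\mathbb{K}}\operatorname{lin}_{\mathbb{K}}\{\bm{\varphi}_x\bm{\varphi}_x^\ast: x\in\Omega\}$, points $x_1,\ldots,x_N\in\Omega$ and weights $\mu_1,\ldots,\mu_N>0$ such that $\bm{\varphi}$ is a Parseval $\widehat{\mu}$-frame with respect to the discrete measure $\widehat{\mu}=\sum_{j=1}^N\mu_j\delta_{x_j}$.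
   Context: $\bm{I}_n$ is the $n\times n$ identity matrix, $\bm{v}^\ast=\overline{\bm{v}}^\top$, $\operatorname{lin}_{\mathbb{K}}$ is the $\mathbb{K}$-linear span, and $\operatorname{cone}M:=\{\sum_{j=1}^m\lambda_jv_j: v_j\in M,\ \lambda_j\ge0,\ m\in\mathbb{N}\}$. For a positive measure space $(\Omega,\Sigma,\mu)$ (measure with values in $[0,\infty]$; in (ii) the $\sigma$-algebra is part of what is asserted to exist), a measurable function $\bm{\varphi}:\Omega\to\mathbb{K}^n$ is a $\mu$-frame for $\mathbb{K}^n$ if there are constants $0<A\le B<\infty$ with $$A\|f\|^2\le\int_\Omega|\langle f,\bm{\varphi}(x)\rangle|^2\,\mathrm{d}\mu(x)\le B\|f\|^2\quad\text{for all } f\in\mathbb{K}^n,$$ and a Parseval $\mu$-frame if one can take $A=B=1$. *)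

(* Defs.v *)
From HB Require Import structures.
From mathcomp Require Import all_boot all_order all_algebra.
From mathcomp Require Import all_classical all_reals all_analysis.
From mathcomp Require Import complex.

Set Implicit Arguments.
Unset Strict Implicit.
Unset Printing Implicit Defensive.

Import Order.TTheory GRing.Theory Num.Theory.
Import numFieldNormedType.Exports.

Local Open Scope classical_set_scope.
Local Open Scope ring_scope.

Variant scalars := RealScalars | ComplexScalars.

Definition RorC (R : realType) (k : scalars) : numFieldType :=
  match k with RealScalars => R | ComplexScalars => R[i] end.

Definition conjK (R : realType) (k : scalars) : RorC R k -> RorC R k :=
  match k with
  | RealScalars => fun z => z
  | ComplexScalars => fun z : R[i] => z^*
  end.

(* The norm of [R[i]] takes its values in [R[i]], whence the real part. *)
Definition absK (R : realType) (k : scalars) : RorC R k -> R :=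
  match k with
  | RealScalars => fun z : R => `|z|
  | ComplexScalars => fun z : R[i] => complex.Re `|z|
  end.

Section Euclidean.
Variables (R : realType) (k : scalars) (n : nat).
Local Notation K := (RorC R k).
Implicit Types f g v : 'cV[K]_n.

Definition adjoint v : 'rV[K]_n := map_mx (@conjK R k) v^T.

Definition inner f g : K := \sum_(i < n) f i 0 * conjK (g i 0).

(* Squared Euclidean norm; the norm that MathComp-Analysis puts on matrices is
   the sup norm. *)
Definition sqnorm f : R := \sum_(i < n) absK (f i 0) ^+ 2.

End Euclidean.

(* In a [numFieldType] such as [R[i]], [0 <= a] forces [a] to be real. *)
Definition cone (K : numFieldType) (V : lmodType K) (M : set V) : set V :=
  [set v | exists (m : nat) (a : 'I_m -> K) (u : 'I_m -> V),
     [/\ forall j, 0 <= a j, forall j, M (u j) & v = \sum_(j < m) a j *: u j]].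

Section LinearSpan.
Variables (K : fieldType) (V : vectType K).
Implicit Types (M : set V) (s : seq V).

Definition lin_comb M : set V :=
  [set v | exists (m : nat) (a : 'I_m -> K) (u : 'I_m -> V),
     (forall j, M (u j)) /\ v = \sum_(j < m) a j *: u j].

Lemma lin_exists M :
  exists U : {vspace V}, forall v, v \in U <-> lin_comb M v.
Proof.
pose P d := `[< exists s, (forall u, u \in s -> M u) /\ \dim << s >> = d >].
have exP : exists d, P d by exists (\dim <<[::] : seq V>>); apply/asboolP; exists [::].
have leP d : P d -> (d <= \dim {:V})%N.
  by move=> /asboolP [s [_ <-]]; exact: dimvS (subvf _).
case: (ex_maxnP exP leP) => d /asboolP [s [sM sd]] dmax.
exists << s >>%VS => v; split.
  move=> /(@coord_span _ _ _ (in_tuple s)) ->.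
  exists (size s), (fun i => coord (in_tuple s) i v), (fun i => s`_i).
  by split=> // j; apply/sM/mem_nth.
move=> [m [a [u [uM ->]]]]; apply: memv_suml => j _; apply: memvZ.
have /dmax : P (\dim <<u j :: s>>).
  apply/asboolP; exists (u j :: s); split=> // w.
  by rewrite inE => /predU1P [-> //|/sM].
have sub : (<< s >> <= <<u j :: s>>)%VS by rewrite span_cons addvSr.
rewrite -sd => le.
have /eqP -> : (<< s >> == <<u j :: s>>)%VS by rewrite eqEdim sub.
by rewrite memv_span// mem_head.
Qed.

Definition lin M : {vspace V} := projT1 (cid (lin_exists M)).

Lemma mem_lin M v : v \in lin M <-> lin_comb M v.
Proof. exact: projT2 (cid (lin_exists M)) v. Qed.

End LinearSpan.

(* [measurableType] extends [pointedType], so a base point is needed to see an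
   arbitrary type as a measurable space; nothing depends on its choice. The
   empty type is thereby excluded: it carries no frame of a nonzero space, the
   integral in the lower frame bound being zero. *)
Definition pointed_at (T : Type) (x0 : T) : Type := T.

HB.instance Definition _ (T : Type) (x0 : T) := gen_eqMixin (pointed_at x0).
HB.instance Definition _ (T : Type) (x0 : T) := gen_choiceMixin (pointed_at x0).
HB.instance Definition _ (T : Type) (x0 : T) :=
  isPointed.Build (pointed_at x0) x0.

(* The measurable sets are those of the sigma-algebra generated by [S], hence
   exactly the members of [S] when [S] is a sigma-algebra. *)
Definition measurable_space (T : Type) (x0 : T) (S : set (set T)) : Type :=
  @g_sigma_algebraType (pointed_at x0) S.

HB.instance Definition _ (T : Type) (x0 : T) (S : set (set T)) :=
  Measurable.copy (measurable_space x0 S)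
    (@g_sigma_algebraType (pointed_at x0) S).

Section DiscreteMeasure.
Local Open Scope ereal_scope.
Context d (T : measurableType d) (R : realType).
Variables (N : nat) (x : 'I_N -> T) (w : 'I_N -> {posnum R}).

Definition discrete_measure (A : set T) : \bar R :=
  \sum_(j < N) (w j)%:num%:E * \d_(x j) A.

Let discrete_measure0 : discrete_measure set0 = 0.
Proof. by rewrite /discrete_measure big1// => j _; rewrite measure0 mule0. Qed.

Let discrete_measure_ge0 A : 0 <= discrete_measure A.
Proof. by apply: sume_ge0 => j _; rewrite mule_ge0// lee_fin. Qed.

Let discrete_measure_sigma_additive : semi_sigma_additive discrete_measure.
Proof.
move=> F mF tF mUF.
rewrite [X in _ --> X](_ : _ =
    limn (fun p => \sum_(0 <= i < p) discrete_measure (F i))).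
  by apply: is_cvg_ereal_nneg_natsum => i _; exact: discrete_measure_ge0.
rewrite nneseries_sum; last first.
  by move=> i j _; rewrite mule_ge0 ?lee_fin.
by apply: eq_bigr => j _; 
  exact: (measure_semi_bigcup (mscale ((w j)%:num%:nng)%R (dirac (x j)))).
Qed.

HB.instance Definition _ := isMeasure.Build d T R discrete_measure
  discrete_measure0 discrete_measure_ge0 discrete_measure_sigma_additive.

End DiscreteMeasure.

Section Frames.
Local Open Scope ereal_scope.
Context d (T : measurableType d) (R : realType) (k : scalars) (n : nat).
Local Notation vec := 'cV[RorC R k]_n.
Variables (mu : {measure set T -> \bar R}) (phi : T -> vec).

Definition borel_measurable :=
  measurable_fun [set: T] (phi : T -> g_sigma_algebraType (@open vec)).

Definition in_L2 :=
  borel_measurable /\ \int[mu]_x (sqnorm (phi x))%:E < +oo.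

Definition frame_with_bounds (A B : R) :=
  [/\ borel_measurable, (0 < A <= B)%R &
    forall f : vec,
      (A * sqnorm f)%:E <= \int[mu]_x (absK (inner f (phi x)) ^+ 2)%:E
                        <= (B * sqnorm f)%:E].

Definition parseval_frame := frame_with_bounds 1 1.

End Frames.

Definition rank_one_family (R : realType) (k : scalars) (n : nat)
    (Omega : Type) (phi : Omega -> 'cV[RorC R k]_n) : set 'M[RorC R k]_n :=
  range (fun x => phi x *m adjoint (phi x)).

(* Main.v *)
Require Import Defs.
From HB Require Import structures.
From mathcomp Require Import all_boot all_order all_algebra.
From mathcomp Require Import all_classical all_reals all_analysis.
From mathcomp Require Import complex.
From mathcomp Require Import measurable_realfun.
From mathcomp Require Import ring.

(** A Parseval identity for weights at finitely many points is the same as a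
    decomposition of the identity matrix into the rank-one matrices of these
    points, because both sides are Hermitian forms and such a form is
    determined by its values (lemma [discrete_parsevalP]). This links
    membership in the cone with discrete Parseval frames.

    The number of points is bounded by a conic version of the theorem of
    Caratheodory, [conic_caratheodory]. Over the complex numbers the bound is
    the dimension of the complex span, although the weights are real: a
    complex relation among Hermitian matrices yields a real one, by adding its
    conjugate transpose.

    The remaining step starts from a Parseval frame for an arbitrary measure.
    The identity matrix is then an integral of rank-one matrices, and the
    point is that it lies in their convex cone itself, although this cone need
    not be closed. This is [weak_integral_in_cone]: in finite dimension a
    convex cone can be properly separated from any vector outside it
    ([proper_separation]), a separating functional must vanish almost
    everywhere on the integrand, and restricting to its zero set lowers the
    dimension of the span. To apply it, the Hermitian matrices are replaced by
    the values of their quadratic forms at finitely many test vectors. These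
    values are real, and their integrals are exactly what the Parseval
    identity provides, so no polarization under the integral sign is needed. *)

Set Implicit Arguments.
Unset Strict Implicit.
Unset Printing Implicit Defensive.
Import Order.TTheory GRing.Theory Num.Theory.
Import numFieldNormedType.Exports.

Local Open Scope classical_set_scope.
Local Open Scope ring_scope.

(** * Convex cones and spans *)

Section ConvexCones.
Variables (K : numFieldType) (U : lmodType K).
Implicit Types M : set U.

Lemma cone_sub M M' : M `<=` M' -> cone M `<=` cone M'.
Proof.
move=> MM' _ [m [a [u [a0 uM ->]]]]; exists m, a, u.
by split=> // j; exact: MM'.
Qed.

Lemma cone_add M x y : cone M x -> cone M y -> cone M (x + y).
Proof.
move=> [m [a [u [a0 uM ->]]]] [p [b [v [b0 vM ->]]]].
exists (m + p)%N,
  (fun j => match fintype.split j with inl i => a i | inr i => b i end),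
  (fun j => match fintype.split j with inl i => u i | inr i => v i end).
split=> [j|j|]; [by case: fintype.splitP..|].
rewrite big_split_ord/=; congr +%R; apply: eq_bigr => i _.
  by rewrite (unsplitK (inl i : 'I_m + 'I_p)).
by rewrite (unsplitK (inr i : 'I_m + 'I_p)).
Qed.

Lemma cone_scale M t x : 0 <= t -> cone M x -> cone M (t *: x).
Proof.
move=> t0 [m [a [u [a0 uM ->]]]]; exists m, (fun j => t * a j), u.
split=> // [j|]; first exact: mulr_ge0.
by rewrite scaler_sumr; apply: eq_bigr => j _; rewrite scalerA.
Qed.

Lemma cone_zero M : cone M 0.
Proof.
exists 0%N, (fun=> 0), (fun=> 0); split=> [j|[]//|]; first exact: lexx.
by rewrite big_ord0.
Qed.

Lemma cone_gen M x : M x -> cone M x.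
Proof.
move=> Mx; exists 1%N, (fun=> 1), (fun=> x).
by split=> [j|//|]; rewrite ?ler01// big_ord1 scale1r.
Qed.

Lemma cone_sum M (I : Type) (r : seq I) (a : I -> K) (f : I -> U) :
  (forall i, 0 <= a i) -> (forall i, cone M (f i)) ->
  cone M (\sum_(i <- r) a i *: f i).
Proof.
move=> a0 fM; elim: r => [|i r IH]; first by rewrite big_nil; exact: cone_zero.
by rewrite big_cons; apply: cone_add => //; exact: cone_scale.
Qed.

Lemma cone_setU1 M w x :
  cone (M `|` [set w]) x -> exists c t, [/\ cone M c, 0 <= t & x = c + t *: w].
Proof.
move=> [m [a [u [a0 uM ->]]]].
pose P (y : U) := exists c t, [/\ cone M c, 0 <= t & y = c + t *: w].
apply: (big_ind P) => [|y z|j _].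
- by exists 0, 0; split; rewrite ?scale0r ?addr0//; exact: cone_zero.
- move=> [c [t [cM t0 ->]]] [c' [t' [cM' t0' ->]]].
  exists (c + c'), (t + t'); split; [exact: cone_add|exact: addr_ge0|].
  by rewrite scalerDl addrACA.
- case: (uM j) => [Mu|->].
  + exists (a j *: u j), 0; split; rewrite ?scale0r ?addr0//.
    by apply: cone_scale => //; exact: cone_gen.
  + by exists 0, (a j); split; rewrite ?add0r//; exact: cone_zero.
Qed.

End ConvexCones.

Lemma mem_lin_gen (K : fieldType) (U : vectType K) (M : set U) u :
  M u -> u \in lin M.
Proof.
move=> Mu; apply/mem_lin; exists 1%N, (fun=> 1), (fun=> u).
by split=> //; rewrite big_ord1 scale1r.
Qed.

Lemma lin_proper (K : fieldType) (U : vectType K) (M M' : set U)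
    (l : {scalar U}) (u : U) :
  M' `<=` M -> (forall w, M' w -> l w = 0) -> M u -> l u != 0 ->
  (\dim (lin M') < \dim (lin M))%N.
Proof.
move=> M'M lM' Mu lu0.
have sub : (lin M' <= lin M)%VS.
  apply/subvP => _ /mem_lin[m [a [w [wM' ->]]]]; apply: memv_suml => j _.
  by apply/memvZ/mem_lin_gen/M'M.
rewrite ltn_neqAle dimvS// andbT; apply/eqP => eq_dim.
have linE : lin M' = lin M by apply/eqP; rewrite eqEdim sub eq_dim leqnn.
have : u \in lin M' by rewrite linE mem_lin_gen.
move=> /mem_lin[m [a [w [wM' uE]]]]; move: lu0.
by rewrite uE linear_sum big1 ?eqxx// => j _; rewrite linearZ/= lM' ?mulr0.
Qed.

Lemma lin_spanned_by_seq (K : fieldType) (U : vectType K) (M : set U) :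
  exists s : seq U, (forall u, u \in s -> M u) /\ << s >>%VS = lin M.
Proof.
have span_le (s : seq U) : (forall u, u \in s -> M u) -> (<< s >> <= lin M)%VS.
  by move=> sM; apply/span_subvP => u us; apply/mem_lin_gen/sM.
suff [s [sM le_s]] : exists s : seq U,
    (forall u, u \in s -> M u) /\ (lin M <= << s >>)%VS.
  by exists s; split=> //; apply/eqP; rewrite eqEsubv span_le.
rewrite -(span_basis (vbasisP (lin M))).
have : forall x, x \in (vbasis (lin M) : seq U) -> lin_comb M x.
  by move=> x xb; apply/mem_lin; exact: vbasis_mem.
(* Each basis vector of the span uses finitely many elements of M: collect
   them all. *)
elim: (vbasis (lin M) : seq U) => [|x r IH] rM.
  by exists [::]; rewrite span_nil sub0v.
have [|s [sM le_s]] := IH; first by move=> y yr; apply: rM; rewrite inE yr orbT.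
have [m [a [u [uM xE]]]] := rM x (mem_head _ _).
exists ([seq u j | j : 'I_m] ++ s); split=> [y|].
  by rewrite mem_cat => /orP[/mapP[j _ ->]|/sM].
rewrite span_cons span_cat; apply: addvS => //.
rewrite -memvE xE; apply: memv_suml => j _; apply/memvZ/memv_span.
by rewrite map_f ?mem_enum.
Qed.

(** * Proper separation from a convex cone *)

Section ConvexSeparation.
Variables (R : realType) (V : vectType R).
Implicit Types (M D : set V) (s : seq V) (W : {vspace V}).

Lemma exists_dual_vector W (b : V) : b \notin W ->
  exists l : {scalar V}, (forall w, w \in W -> l w = 0) /\ l b = 1.
Proof.
move=> bW; pose X := in_tuple (b :: vbasis W).
have freeX : free X.
  by rewrite free_cons (basis_free (vbasisP W)) (span_basis (vbasisP W)) bW.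
exists (coord X ord0); split=> [w /coord_vbasis ->|]; last first.
  exact: coord_free ord0 ord0 freeX.
rewrite linear_sum big1// => i _; rewrite linearZ/=.
have ltiX : (i.+1 < size (b :: vbasis W))%N by rewrite /= ltnS size_tuple.
have -> : coord X ord0 (vbasis W)`_i = 0.
  exact: coord_free (Ordinal ltiX) ord0 freeX.
by rewrite mulr0.
Qed.

(** Hahn-Banach in the form of M. Riesz: [e] is an order unit for [D] on the
    span of [s], and a positive functional with value 1 at [e] is extended one
    vector [b] at a time. The admissible values at [b] form an interval whose
    ends are given by the elements of [W + b] and of [W - b] that lie in [D];
    the order unit makes both families nonempty, so the interval is bounded
    and its left end is a legitimate value. *)
Lemma nonneg_extension D (e : V) s :
  (forall x y, D x -> D y -> D (x + y)) ->
  (forall t x, 0 <= t -> D x -> D (t *: x)) ->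
  D e -> ~ D (- e) ->
  (forall b, b \in s -> exists t, D (t *: e + b) /\ D (t *: e - b)) ->
  exists l : {scalar V},
    l e = 1 /\ forall x, x \in <<e :: s>>%VS -> D x -> 0 <= l x.
Proof.
move=> DD DZ De DNe; elim: s => [|b s IH] unit_s.
  have e0 : e \notin 0%VS.
    rewrite memv0; apply: contra_notN DNe => /eqP e0.
    by rewrite e0 oppr0 -(scale0r e); apply: DZ.
  have [l [_ le]] := exists_dual_vector e0.
  exists l; split=> // x; rewrite span_seq1 => /vlineP[a ->] Dae.
  rewrite linearZ/= le mulr1 leNgt; apply/negP => a0; apply: DNe.
  have -> : - e = (- a^-1) *: (a *: e).
    by rewrite scalerA mulNr mulVf ?lt_eqF// scaleN1r.
  by apply: DZ => //; rewrite oppr_ge0 invr_le0 ltW.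
have [b' b's|l [le l_ge0]] := IH.
  by apply: unit_s; rewrite inE b's orbT.
set W := <<e :: s>>%VS in l_ge0.
have sW : <<e :: b :: s>>%VS = (<[b]> + W)%VS.
  by rewrite /W !span_cons !addvA [(<[b]> + _)%VS]addvC.
have [bW|bW] := boolP (b \in W).
  exists l; split=> // x; rewrite sW.
  by move: bW; rewrite memvE => /addv_idPr ->; exact: l_ge0.
have [chi [chiW chib]] := exists_dual_vector bW.
have [t [Dtb Dt_b]] := unit_s b (mem_head _ _).
have eW : e \in W by rewrite memv_span// mem_head.
have teW : t *: e \in W by rewrite memvZ.
(* The lower bounds on the value at b. *)
pose A := [set - l w | w in [set w | w \in W /\ D (w + b)]].
have A_le w' : w' \in W -> D (w' - b) -> ubound A (l w').
  move=> w'W Dw' _ [w [wW Dw] <-].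
  rewrite -subr_ge0 opprK -linearD; apply: l_ge0; first by rewrite memvD.
  have -> : w' + w = (w' - b) + (w + b) by rewrite addrACA addNr addr0.
  exact: DD.
have A0 : A !=set0 by exists (- l (t *: e)), (t *: e).
have supA : has_sup A by split=> //; exists (l (t *: e)); exact: A_le.
pose c := sup A.
(* Changing l by a multiple of chi gives b the value c and keeps l on W. *)
pose f x := l x + (c - l b) * chi x.
have f_linear : scalar f by move=> a x y; rewrite /f !linearP/=; ring.
pose l' : {scalar V} := HB.pack f (GRing.isLinear.Build R V R *%R f f_linear).
have l'W w : w \in W -> l' w = l w.
  by move=> wW; rewrite /=/f chiW// mulr0 addr0.
have l'b : l' b = c by rewrite /=/f chib mulr1 addrC subrK.
exists l'; split=> [|x]; first by rewrite l'W.
rewrite sW => /memv_addP[_ /vlineP[a ->]] [w wW ->] Dx.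
rewrite linearD linearZ [l' b]l'b l'W//=.
have [a0|a0|a0] := ltrgt0P a.
- have : - l (a^-1 *: w) <= c.
    apply: ub_le_sup; first by case: supA.
    exists (a^-1 *: w) => //; split; first by rewrite memvZ.
    have -> : a^-1 *: w + b = a^-1 *: (a *: b + w).
      by rewrite scalerDr scalerA mulVf ?gt_eqF// scale1r addrC.
    by apply: DZ => //; rewrite invr_ge0 ltW.
  by rewrite linearZ/= lerNl ler_pdivlMl// mulrN -subr_ge0 opprK addrC.
- have : c <= l ((- a)^-1 *: w).
    apply: ge_sup => //; apply: A_le; first by rewrite memvZ.
    have -> : (- a)^-1 *: w - b = (- a)^-1 *: (a *: b + w).
      rewrite scalerDr scalerA invrN mulNr mulVf ?lt_eqF// scaleN1r addrC//.
    by apply: DZ => //; rewrite invr_ge0 oppr_ge0 ltW.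
  by rewrite linearZ/= ler_pdivlMl ?oppr_gt0// mulNr -subr_ge0 opprK addrC.
- rewrite a0 mul0r add0r; apply: l_ge0 => //.
  by move: Dx; rewrite a0 scale0r add0r.
Qed.

(** The cone need not be closed, so [l v] can be zero; the last clause keeps
    the separation proper. Adjoining [- v] to the generators gives a cone [D]
    that misses [v]. The sum [e] of a finite spanning family of generators is
    an order unit of [D] on its span, and [- e] lies outside [D], since
    otherwise [D] would be the whole span and contain [v]. The functional
    provided by [nonneg_extension] takes the value 1 at [e], hence is positive
    at one of the generators. *)
Lemma proper_separation M (v : V) : ~ cone M v ->
  exists l : {scalar V}, [/\ forall u, M u -> 0 <= l u, l v <= 0 &
    (exists2 u, M u & 0 < l u) \/ l v < 0].
Proof.
move=> vM; pose M' := M `|` [set - v]; pose D := cone M'.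
have [s [sM' sE]] := lin_spanned_by_seq M'.
have M'_lin u : M' u -> u \in << s >>%VS.
  by rewrite sE; exact: mem_lin_gen.
pose e := \sum_(i < size s) s`_i.
have Ds (i : 'I_(size s)) : D s`_i by apply/cone_gen/sM'/mem_nth.
have De : D e.
  rewrite /e; under eq_bigr do rewrite -[s`_ _]scale1r.
  by apply: cone_sum => // i; exact: ler01.
have unit_span b : b \in << s >>%VS -> exists2 t, 0 <= t & D (t *: e + b).
  move=> bs; pose c i := coord (in_tuple s) i b.
  have bE : b = \sum_i c i *: s`_i by exact: (@coord_span _ _ _ (in_tuple s)).
  exists (\sum_i `|c i|); first exact: sumr_ge0.
  rewrite [X in _ + X]bE /e scaler_sumr -big_split/=.
  under eq_bigr do rewrite -scalerDl.
  apply: cone_sum => // i.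
  rewrite -[c i]opprK subr_ge0 (le_trans (ler_norm _))// normrN.
  by rewrite (bigD1 i)//= lerDl sumr_ge0.
have vs : v \in << s >>%VS by rewrite -memvN; apply: M'_lin; right.
have DNe : ~ D (- e).
  have [t t0 Dtv] := unit_span v vs.
  move=> DNe; have : D v.
    have -> : v = (t *: e + v) + t *: (- e).
      by rewrite scalerN addrAC subrr add0r.
    by apply: cone_add => //; exact: cone_scale.
  move=> /cone_setU1[c [r [cM r0 vE]]]; apply: vM.
  (* v + r v lies in the cone of M, hence so does v. *)
  have r1 : 0 < 1 + r by rewrite ltr_wpDr.
  have -> : v = (1 + r)^-1 *: c.
    apply: (scalerI (lt0r_neq0 r1)); rewrite scalerA mulfV ?gt_eqF// scale1r.
    by rewrite scalerDl scale1r {1}vE scalerN subrK.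
  by apply: cone_scale => //; rewrite invr_ge0 ltW.
have unit_s b : b \in s -> exists t, D (t *: e + b) /\ D (t *: e - b).
  move=> bs; have [t t0 Dt] := unit_span b (memv_span bs).
  have [|t' t0' Dt'] := unit_span (- b); first by rewrite memvN memv_span.
  exists (t + t'); split; rewrite scalerDl.
    by rewrite addrAC; apply: cone_add => //; exact: cone_scale.
  by rewrite -addrA; apply: cone_add => //; exact: cone_scale.
have [l [le l_ge0]] := nonneg_extension (@cone_add _ _ M') (@cone_scale _ _ M')
  De DNe unit_s.
have l_M' u : M' u -> 0 <= l u.
  move=> M'u; apply: l_ge0; last exact: cone_gen.
  by rewrite span_cons (subvP (addvSr _ _))// M'_lin.
exists l; split; first by move=> u Mu; apply: l_M'; left.
  by rewrite -oppr_ge0 -linearN; apply: l_M'; right.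
have : exists2 u, M' u & 0 < l u.
  apply: contrapT => noM'; have : l e <= 0.
    rewrite /e linear_sum; apply: sumr_le0 => i _; rewrite leNgt.
    by apply/negP => ls; apply: noM'; exists s`_i => //; apply/sM'/mem_nth.
  by rewrite le leNgt ltr01.
case=> u [Mu|->] lu; first by left; exists u.
by right; rewrite -oppr_gt0 -linearN.
Qed.

End ConvexSeparation.

(** * Integrals and convex cones *)

(** The cone of the values need not be closed, so approximating the integral
    by finite sums is not enough; separation and a descent on the dimension
    replace it. Among the sets of full measure take [E] such that the values
    on [E] span a space of least dimension, and suppose that [v] is outside
    the cone of these values. A properly separating [l] satisfies [0 <= l v]
    by integration and [l v <= 0] by separation, so [l \o g] is a nonnegative
    function on [E] of integral zero. It therefore vanishes on a smaller set
    of full measure, where the values of [g] lie in the kernel of [l] and span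
    a space of smaller dimension. The integral is taken in the weak sense,
    through the functionals. *)
Lemma weak_integral_in_cone d (T : measurableType d) (R : realType)
    (mu : {measure set T -> \bar R}) (V : vectType R) (g : T -> V) (v : V) :
  (forall l : {scalar V}, mu.-integrable setT (fun x => (l (g x))%:E) /\
     (\int[mu]_x (l (g x))%:E = (l v)%:E)%E) ->
  cone (range g) v.
Proof.
move=> int_g.
pose P k := `[< exists E, [/\ measurable E, mu (~` E) = 0%E &
  \dim (lin (g @` E)) = k] >].
have exP : exists k, P k.
  exists (\dim (lin (range g))); apply/asboolP; exists setT.
  by split; rewrite ?setCT ?measure0.
case: (ex_minnP exP) => k /asboolP[E [mE E0 dimE]] k_min.
apply: contrapT => vg.
have vgE : ~ cone (g @` E) v.
  by apply: contra_not vg; apply: cone_sub; exact: image_subset.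
have [l [l_ge0 lv sep]] := proper_separation vgE.
pose f (x : T) : \bar R := (l (g x))%:E.
have [int_f f_v] := int_g l.
have mf : measurable_fun E f.
  by apply: measurable_funTS; exact: (measurable_int mu).
have f_E : (\int[mu]_(x in E) f x = (l v)%:E)%E.
  rewrite -f_v (negligible_integral (measurableC mE) measurableT int_f E0).
  by rewrite setTD setCK.
have f_ge0 x : E x -> (0 <= f x)%E.
  by move=> Ex; rewrite lee_fin; apply: l_ge0; exists x.
have lv0 : l v = 0.
  apply/eqP; rewrite eq_le lv -lee_fin -f_E.
  by apply: integral_ge0 => x; exact: f_ge0.
have f_ae0 : ae_eq mu E f (cst 0%E).
  apply/ae_eq_integral_abs => //; rewrite -[RHS]/(0%:E) -lv0 -f_E.
  by apply: eq_integral => x /set_mem Ex; rewrite gee0_abs// f_ge0.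
pose E' := E `&` [set x | f x = 0%E].
have mE' : measurable E' by apply: measurable_eqe => //; exact: measurable_cst.
have E'0 : mu (~` E') = 0%E.
  apply/negligibleP; first exact: measurableC.
  have := negligibleU ((negligibleP mu (measurableC mE)).2 E0) f_ae0.
  apply: negligibleS => x; rewrite /E' setCI => -[nEx|fx]; first by left.
  have [Ex|nEx] := pselect (E x); last by left.
  by right => /= /(_ Ex).
case: sep => [[_ [x Ex <-] lgx]|]; last by rewrite lv0 ltxx.
have : (\dim (lin (g @` E')) < \dim (lin (g @` E)))%N.
  apply: (@lin_proper _ _ _ _ l (g x)); last by rewrite gt_eqF.
  - by apply: image_subset => y [].
  - by move=> _ [y [_ /= [+]] <-].
  - by exists x.
by rewrite ltnNge dimE k_min//; apply/asboolP; exists E'.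
Qed.

(** * Real and complex scalars *)

Definition realK (R : realType) (k : scalars) : R -> RorC R k :=
  match k with
  | RealScalars => fun t => t
  | ComplexScalars => fun t => (t%:C)%C
  end.

(** The scalar [c] for which [e_p + c e_q] supplements [e_p + e_q] in a
    polarization identity; over the reals [e_p + e_q] suffices, and the value 1
    repeats it. *)
Definition imagK (R : realType) (k : scalars) : RorC R k :=
  match k with
  | RealScalars => 1
  | ComplexScalars => 'i%C
  end.

Section Scalars.
Variables (R : realType) (k : scalars).
Local Notation K := (RorC R k).
Local Notation conjK := (@conjK R k).
Local Notation realK := (@realK R k).
Implicit Types (z : K) (t : R).

Lemma conjK_zmod_morphism : zmod_morphism conjK.
Proof. by case: k => // x y /=; rewrite rmorphB. Qed.

Lemma conjK_monoid_morphism : monoid_morphism conjK.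
Proof. by case: k => //; split=> [|x y] /=; rewrite ?rmorph1 ?rmorphM. Qed.

HB.instance Definition _ :=
  GRing.isZmodMorphism.Build K K conjK conjK_zmod_morphism.
HB.instance Definition _ :=
  GRing.isMonoidMorphism.Build K K conjK conjK_monoid_morphism.

Lemma realK_zmod_morphism : zmod_morphism realK.
Proof. by case: k => // x y /=; rewrite rmorphB. Qed.

Lemma realK_monoid_morphism : monoid_morphism realK.
Proof. by case: k => //; split=> [|x y] /=; rewrite ?rmorph1 ?rmorphM. Qed.

HB.instance Definition _ :=
  GRing.isZmodMorphism.Build R K realK realK_zmod_morphism.
HB.instance Definition _ :=
  GRing.isMonoidMorphism.Build R K realK realK_monoid_morphism.

Lemma conjKK : involutive conjK.
Proof. by case: k => // z /=; rewrite conjCK. Qed.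

Lemma conj_realK t : conjK (realK t) = realK t.
Proof. by case: k => //=; apply/CrealP/complex_realP; exists t. Qed.

Lemma realK_inj : injective realK.
Proof. by case: k => // s t /= []. Qed.

Lemma ler_realK : {mono realK : s t / s <= t}.
Proof. by case: k => //= s t; rewrite lecR. Qed.

Lemma ltr_realK : {mono realK : s t / s < t}.
Proof. exact: leW_mono ler_realK. Qed.

Lemma ge0_realK z : 0 <= z -> exists2 t, 0 <= t & z = realK t.
Proof.
case: k z => [z z0|[x y]] /=; first by exists z.
by rewrite lecE/= => /andP[/eqP -> x0]; exists x.
Qed.

Lemma realK_sqr_abs z : realK (absK z ^+ 2) = z * conjK z.
Proof.
case: k z => z /=; first by rewrite real_normK ?num_real// expr2.
by rewrite -normCK rmorphXn/=; congr (_ ^+ 2); exact/RRe_real/normr_real.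
Qed.

Lemma sqr_abs_gt0 z : z != 0 -> 0 < absK z ^+ 2.
Proof.
by move=> z0; rewrite lt_def sqr_ge0 andbT -(inj_eq realK_inj) rmorph0
  realK_sqr_abs mulf_neq0// fmorph_eq0.
Qed.

Lemma add_conjK_real z : exists t, z + conjK z = realK t.
Proof.
case: k z => [z|z] /=; first by exists (z + z).
exists (complex.Re (z + z^*)).
by rewrite RRe_real// CrealE rmorphD/= conjCK addrC.
Qed.

(** Over the complex numbers the two sums are twice the real part of [z] and,
    up to sign, twice its imaginary part; over the reals both are twice [z]. *)
Lemma polarization_eq0 z :
  z + conjK z = 0 -> imagK R k * z + conjK (imagK R k * z) = 0 -> z = 0.
Proof.
case: k z => [z|z] /=.
  by rewrite -mulr2n => /eqP; rewrite mulrn_eq0/= => /eqP ->.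
rewrite complexiE rmorphM/= conjCi mulNr => /eqP; rewrite addr_eq0 => /eqP zE.
move=> /eqP; rewrite -mulrBr mulf_eq0 (negPf (neq0Ci _))/= subr_eq0 => /eqP zE'.
by move/eqP: zE; rewrite -zE' -addr_eq0 -mulr2n mulrn_eq0/= => /eqP.
Qed.

Lemma realK_abs z : realK (absK z) = `|z|.
Proof. by case: k z => z //=; exact/RRe_real/normr_real. Qed.

Lemma norm_realK t : `|realK t| = realK `|t|.
Proof. by case: k => //=; rewrite normc_def/= expr0n addr0 sqrtr_sqr. Qed.

End Scalars.

(** * Hermitian forms and frame operators *)

Section FrameOperator.
Variables (R : realType) (k : scalars).
Local Notation K := (RorC R k).
Local Notation conjK := (@conjK R k).
Local Notation realK := (@realK R k).

Definition conjT m p (A : 'M[K]_(m, p)) : 'M[K]_(p, m) := map_mx conjK A^T.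

Lemma conjTD m p (A B : 'M[K]_(m, p)) : conjT (A + B) = conjT A + conjT B.
Proof. by rewrite /conjT raddfD map_mxD. Qed.

Lemma conjTB m p (A B : 'M[K]_(m, p)) : conjT (A - B) = conjT A - conjT B.
Proof. by rewrite /conjT raddfB map_mxB. Qed.

Lemma conjTZ m p (A : 'M[K]_(m, p)) c : conjT (c *: A) = conjK c *: conjT A.
Proof. by rewrite /conjT linearZ map_mxZ. Qed.

Lemma conjTM m p q (A : 'M[K]_(m, p)) (B : 'M[K]_(p, q)) :
  conjT (A *m B) = conjT B *m conjT A.
Proof. by rewrite /conjT trmx_mul map_mxM. Qed.

Lemma conjTK m p (A : 'M[K]_(m, p)) : conjT (conjT A) = A.
Proof. by apply/matrixP => i j; rewrite !mxE conjKK. Qed.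

Lemma conjT_sum m p (I : Type) (r : seq I) (F : I -> 'M[K]_(m, p)) :
  conjT (\sum_(i <- r) F i) = \sum_(i <- r) conjT (F i).
Proof.
apply: (big_morph _ (@conjTD m p)).
by rewrite /conjT trmx0 map_mx0.
Qed.

Lemma conjT1 m : conjT (1%:M : 'M[K]_m) = 1%:M.
Proof. by rewrite /conjT trmx1 map_mx1. Qed.

Variable n : nat.
Implicit Types (f g : 'cV[K]_n) (A H : 'M[K]_n).

Lemma adjointE f : adjoint f = conjT f. Proof. by []. Qed.

Lemma innerE f g : inner f g = (adjoint g *m f) 0 0.
Proof. by rewrite mxE; apply: eq_bigr => i _; rewrite !mxE mulrC. Qed.

Lemma conj_inner f g : conjK (inner f g) = inner g f.
Proof.
rewrite /inner rmorph_sum; apply: eq_bigr => i _.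
by rewrite rmorphM/= conjKK mulrC.
Qed.

Definition quadform A f : K := (adjoint f *m A *m f) 0 0.

Lemma quadform_rank_one f g :
  quadform (g *m adjoint g) f = realK (absK (inner f g) ^+ 2).
Proof.
rewrite realK_sqr_abs conj_inner !innerE /quadform mulmxA -mulmxA.
by rewrite [LHS]mxE big_ord1 mulrC.
Qed.

Lemma quadform1 f : quadform 1%:M f = realK (sqnorm f).
Proof.
rewrite /quadform mulmx1 -innerE /sqnorm rmorph_sum.
by apply: eq_bigr => i _; rewrite /= realK_sqr_abs.
Qed.

Lemma quadformB A B f : quadform (A - B) f = quadform A f - quadform B f.
Proof. by rewrite /quadform mulmxBr mulmxBl !mxE. Qed.

Lemma quadform_sum m (a : 'I_m -> R) (F : 'I_m -> 'M[K]_n) f :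
  quadform (\sum_j realK (a j) *: F j) f =
  \sum_j realK (a j) * quadform (F j) f.
Proof.
rewrite /quadform mulmx_sumr mulmx_suml summxE; apply: eq_bigr => j _.
by rewrite -scalemxAr -scalemxAl mxE.
Qed.

(** The vectors [e_p], [e_p + e_q] and [e_p + i e_q]: finitely many test
    vectors that already determine a Hermitian form, so that a Parseval
    identity is a finite system of real equations. *)
Definition probe (i : 'I_n * 'I_n * option bool) : 'cV[K]_n :=
  let: (p, q, s) := i in
  delta_mx p 0 +
    (if s is Some b then if b then imagK R k else 1 else 0) *: delta_mx q 0.

Lemma conjT_delta (m p : nat) (i : 'I_m) (j : 'I_p) :
  conjT (delta_mx i j : 'M[K]_(m, p)) = delta_mx j i.
Proof. by rewrite /conjT trmx_delta map_delta_mx. Qed.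

Lemma quadform_two H p q c : conjT H = H ->
  quadform H (delta_mx p 0 + c *: delta_mx q 0) =
  H p p + (c * H p q + conjK (c * H p q)) + c * conjK c * H q q.
Proof.
move=> HH; have Hqp : H q p = conjK (H p q) by rewrite -{1}HH !mxE.
have deltaE i j : (delta_mx 0 i *m H *m delta_mx j 0 : 'M[K]_1) 0 0 = H i j.
  by rewrite -rowE -colE !mxE.
rewrite /quadform adjointE conjTD conjTZ !conjT_delta !(mulmxDl, mulmxDr).
rewrite -!(scalemxAr, scalemxAl).
have addE (A B : 'M[K]_1) : (A + B) 0 0 = A 0 0 + B 0 0 by rewrite mxE.
have scaleE b (A : 'M[K]_1) : (b *: A) 0 0 = b * A 0 0 by rewrite mxE.
by rewrite !(addE, scaleE, deltaE) Hqp rmorphM; ring.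
Qed.

(** The diagonal entries are the values at [e_p]; once they vanish, the values
    at [e_p + c e_q] are [c H_pq] plus its conjugate. *)
Lemma hermitian_eq0 H : conjT H = H -> (forall i, quadform H (probe i) = 0) ->
  H = 0.
Proof.
move=> HH H0.
have diag0 p : H p p = 0.
  have := H0 (p, p, None).
  by rewrite /probe quadform_two// !(mul0r, rmorph0, addr0).
apply/matrixP => p q; rewrite [RHS]mxE; apply: polarization_eq0.
- have := H0 (p, q, Some false).
  by rewrite /probe quadform_two// !diag0 mulr0 addr0 add0r !mul1r.
- have := H0 (p, q, Some true).
  by rewrite /probe quadform_two// !diag0 mulr0 addr0 add0r.
Qed.

Variables (m : nat) (a : 'I_m -> R) (g : 'I_m -> 'cV[K]_n).

(** The quadratic form of the frame operator is the discrete frame sum, and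
    that of the identity is the squared norm. Together with [hermitian_eq0]
    this makes the Parseval identity for weights [a] equivalent to a
    decomposition of the identity matrix. *)
Lemma tight_of_resolution f :
  1%:M = \sum_j realK (a j) *: (g j *m adjoint (g j)) ->
  \sum_j a j * absK (inner f (g j)) ^+ 2 = sqnorm f.
Proof.
move=> E; apply: (@realK_inj _ k); rewrite -quadform1 E quadform_sum rmorph_sum.
by apply: eq_bigr => j _; rewrite quadform_rank_one rmorphM.
Qed.

Lemma resolution_of_tight :
  (forall i,
    \sum_j a j * absK (inner (probe i) (g j)) ^+ 2 = sqnorm (probe i)) ->
  1%:M = \sum_j realK (a j) *: (g j *m adjoint (g j)).
Proof.
move=> E; apply/eqP; rewrite -subr_eq0; apply/eqP/hermitian_eq0.
  rewrite conjTB conjT1 conjT_sum; congr (_ - _); apply: eq_bigr => j _.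
  by rewrite conjTZ conj_realK conjTM adjointE conjTK.
move=> i; rewrite quadformB quadform1 -E quadform_sum rmorph_sum.
apply/eqP; rewrite subr_eq0; apply/eqP; apply: eq_bigr => j _.
by rewrite quadform_rank_one rmorphM.
Qed.

End FrameOperator.

(** * Conic Caratheodory theorem for Hermitian matrices *)

Section Caratheodory.
Variables (R : realType) (k : scalars) (n : nat).
Local Notation K := (RorC R k).
Local Notation conjK := (@conjK R k).
Local Notation realK := (@realK R k).
Variables (X : Type) (F : X -> 'M[K]_n).
Hypothesis F_herm : forall x, conjT (F x) = F x.

Definition nonneg_rep (A : 'M[K]_n) N (x : 'I_N -> X) (a : 'I_N -> R) :=
  (forall j, 0 <= a j) /\ A = \sum_j realK (a j) *: F (x j).

Lemma nonneg_rep_drop A N (x : 'I_N -> X) (a : 'I_N -> R) j0 :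
  nonneg_rep A x a -> a j0 = 0 -> exists (y : 'I_N.-1 -> X) b, nonneg_rep A y b.
Proof.
move=> [a0 ->] aj0; exists (fun i => x (lift j0 i)), (fun i => a (lift j0 i)).
by split=> //; rewrite (bigD1_ord j0)//= aj0 rmorph0 scale0r add0r.
Qed.

(** Over the complex numbers the dimension bound is the one of the complex
    span, and yields a complex linear relation only. Its coefficients may be
    rotated so that one of them is positive; adding the conjugate transpose of
    the relation, which has the same Hermitian matrices, makes them all real. *)
Lemma real_relation N (x : 'I_N -> X) : (\dim (lin (range F)) < N)%N ->
  exists r : 'I_N -> R, \sum_j realK (r j) *: F (x j) = 0 /\ exists j, 0 < r j.
Proof.
move=> ltN; pose X_ := [tuple F (x j) | j < N].
have : ~~ free X_.
  apply/negP; rewrite /free size_tuple => /eqP dimX.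
  move: ltN; rewrite ltnNge -dimX dimvS//; apply/span_subvP => u /mapP[j _ ->].
  by apply: mem_lin_gen; exists (x j).
move=> /freeP/existsNP[c /not_implyP[cX /existsNP[j0 /eqP cj0]]].
pose z j := conjK (c j0) * c j.
have rP j : exists t, z j + conjK (z j) = realK t := add_conjK_real (z j).
exists (fun j => sval (cid (rP j))).
have realr j : realK (sval (cid (rP j))) = z j + conjK (z j).
  exact/esym/(svalP (cid (rP j))).
have cF0 : \sum_j c j *: F (x j) = 0.
  by rewrite -[RHS]cX; apply: eq_bigr => j _; rewrite -tnth_nth tnth_mktuple.
have zF0 : \sum_j z j *: F (x j) = 0.
  rewrite -[RHS](scaler0 _ (conjK (c j0))) -[in RHS]cF0 scaler_sumr.
  by apply: eq_bigr => j _; rewrite scalerA.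
split.
  under eq_bigr do rewrite realr scalerDl.
  rewrite big_split/= zF0 add0r.
  transitivity (conjT (\sum_j z j *: F (x j))).
    by rewrite conjT_sum; apply: eq_bigr => j _; rewrite conjTZ F_herm.
  by rewrite zF0 /conjT trmx0 map_mx0.
exists j0; rewrite -(@ltr_realK _ k) realr rmorph0.
rewrite /z rmorphM/= conjKK [c j0 * _]mulrC -mulr2n pmulrn_lgt0// mulrC.
by rewrite -realK_sqr_abs -(rmorph0 realK) ltr_realK sqr_abs_gt0.
Qed.

(** A representation with the least number of terms has positive weights. If
    it had more terms than the dimension, a real relation with a positive
    coefficient could be subtracted, with the largest multiple that keeps all
    weights nonnegative; this annihilates one of the weights and shortens the
    representation. *)
Lemma conic_caratheodory A :
  (exists m (x : 'I_m -> X) (a : 'I_m -> R), nonneg_rep A x a) ->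
  exists N, (N <= \dim (lin (range F)))%N /\
  exists (x : 'I_N -> X) (a : 'I_N -> R),
    (forall j, 0 < a j) /\ A = \sum_j realK (a j) *: F (x j).
Proof.
move=> [m [x [a xa]]].
pose P N := `[< exists (x : 'I_N -> X) a, nonneg_rep A x a >].
have exP : exists N, P N by exists m; apply/asboolP; exists x, a.
case: (ex_minnP exP) => {m x a xa} N /asboolP[x [a xa]] N_min.
(* Minimality of N forbids a vanishing weight. *)
have drop y b j : @nonneg_rep A N y b -> b j != 0.
  move=> yb; apply/eqP => bj; have /asboolP/N_min := nonneg_rep_drop yb bj.
  by case: N j {x a xa N_min yb bj y b} => [[]//|N] _; rewrite ltnn.
have a_gt0 j : 0 < a j by rewrite lt_def (drop x a)//=; case: xa.
exists N; split; last by exists x, a; split => //; case: xa.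
rewrite leqNgt; apply/negP => /(real_relation x)[r [rF [j0 rj0]]].
have [j1 rj1 j1_min] : exists2 j1, 0 < r j1 &
    forall j, 0 < r j -> a j1 / r j1 <= a j / r j.
  by case: (@Order.TotalTheory.arg_minP _ _ _ j0 (fun j => 0 < r j)
      (fun j => a j / r j) rj0) => j1 ? ?; exists j1.
pose t := a j1 / r j1.
have t0 : 0 <= t by rewrite divr_ge0// ltW.
have rep' : nonneg_rep A x (fun j => a j - t * r j).
  split=> [j|].
    rewrite subr_ge0; have [rj|rj] := ltP 0 (r j).
      by rewrite -ler_pdivlMr// j1_min.
    by rewrite (le_trans _ (ltW (a_gt0 j)))// mulr_ge0_le0.
  case: xa => _ ->.
  under [RHS]eq_bigr do rewrite rmorphB rmorphM scalerBl -scalerA.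
  by rewrite sumrB -scaler_sumr rF scaler0 subr0.
by have := drop _ _ j1 rep'; rewrite /t/= (divfK (lt0r_neq0 rj1)) subrr eqxx.
Qed.

End Caratheodory.

(** * Continuity and measurability *)

Section Continuity.
Variables (R : realType) (k : scalars).
Local Notation K := (RorC R k).
Local Notation realK := (@realK R k).

Lemma absK_continuous : continuous (@absK R k).
Proof.
move=> z; apply/(@cvgrPdist_lt _ _ _ _ (nbhs_filter z)) => e e0.
have e'0 : 0 < realK e by rewrite -(rmorph0 realK) ltr_realK.
apply/nbhs_ballP; exists (realK e) => //= w zw.
rewrite -(@ltr_realK _ k) -norm_realK rmorphB/= !realK_abs.
exact: le_lt_trans (ler_dist_dist _ _) zw.
Qed.

Variable n : nat.

Lemma inner_sqr_continuous (f : 'cV[K]_n) :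
  continuous (fun v => absK (inner f v) ^+ 2).
Proof.
have -> : (fun v => absK (inner f v) ^+ 2) =
    (fun t : R => t ^+ 2) \o @absK R k \o (fun v => inner v f).
  apply/funext => v /=; apply: (@realK_inj _ k).
  by rewrite !realK_sqr_abs !conj_inner mulrC.
move=> v; apply: continuous_comp; last first.
  by apply: continuous_comp; [exact: absK_continuous|exact: exprn_continuous].
move: v; apply: continuous_big => [|i _ v]; first exact: add_continuous.
by apply: cvgMr_tmp; [exact: nbhs_filter|exact: coord_continuous].
Qed.

End Continuity.

Lemma borel_comp_measurable d (T : measurableType d) (R : realType) k n
    (phi : T -> 'cV[RorC R k]_n) (h : 'cV[RorC R k]_n -> R) :
  borel_measurable phi -> continuous h -> measurable_fun setT (h \o phi).
Proof.
move=> mphi /continuousP ch.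
apply: (measurability _ (RGenOpens.measurableE R)) => _ [_ [a [b ->] <-]].
rewrite setTI comp_preimage -[X in measurable X]setTI; apply: mphi => //.
apply: sub_sigma_algebra; exact/ch/interval_open.
Qed.

(** * Integration against a discrete measure *)

Section DiscreteIntegral.
Local Open Scope ereal_scope.
Context d (T : measurableType d) (R : realType).
Variables (N : nat) (x : 'I_N -> T) (w : 'I_N -> {posnum R}).

Lemma integral_discrete_measure (f : T -> \bar R) :
  measurable_fun setT f -> (forall y, 0 <= f y) ->
  \int[discrete_measure x w]_y f y = \sum_(j < N) (w j)%:num%:E * f (x j).
Proof.
move=> mf f0.
pose c (j : 'I_N) : {nonneg R} := NngNum (ltW [gt0 of (w j)%:num]%R).
(* Finite sums of measures are indexed by nat: pad with the zero measure. *)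
pose m_ (i : nat) : {measure set T -> \bar R} :=
  match insub i : option 'I_N with
  | Some j => mscale (c j) (dirac (x j))
  | None => mzero end.
rewrite (eq_measure_integral (msum m_ N)); last first.
  move=> A mA _; rewrite /discrete_measure /msum; apply: eq_bigr => j _.
  by rewrite /m_ valK.
rewrite ge0_integral_measure_sum//; apply: eq_bigr => j _.
rewrite /m_ valK ge0_integral_mscale// integral_dirac// diracE.
by rewrite mem_set// mul1e.
Qed.

End DiscreteIntegral.

(** * Parseval frames *)

Section ParsevalFrames.
Variables (R : realType) (k : scalars) (n : nat).
Local Notation K := (RorC R k).
Local Notation vec := 'cV[K]_n.

Definition rank_one (v : vec) : 'M[K]_n := v *m adjoint v.

Lemma rank_one_herm v : conjT (rank_one v) = rank_one v.
Proof. by rewrite conjTM adjointE conjTK. Qed.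

Section Measure.
Context d (T : measurableType d).
Implicit Type phi : T -> vec.

Lemma measurable_inner_sqr phi (f : vec) : borel_measurable phi ->
  measurable_fun setT (fun x => (absK (inner f (phi x)) ^+ 2)%:E).
Proof.
move=> mphi; apply/measurable_EFinP.
exact: borel_comp_measurable mphi (@inner_sqr_continuous _ _ _ f).
Qed.

Lemma parseval_integral (mu : {measure set T -> \bar R}) phi f :
  parseval_frame mu phi ->
  (\int[mu]_x (absK (inner f (phi x)) ^+ 2)%:E = (sqnorm f)%:E)%E.
Proof. by move=> [_ _ /(_ f)]; rewrite mul1r => /le_anti ->. Qed.

(** The Parseval identities at the test vectors say that the squared norms of
    the test vectors are the integral of the vector [g] of squared inner
    products, hence lie in the cone of its values; the coefficients found
    there decompose the identity matrix. *)
Lemma parseval_nonneg_rep (mu : {measure set T -> \bar R}) phi :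
  parseval_frame mu phi -> exists m (x : 'I_m -> T) a,
    nonneg_rep (rank_one \o phi) 1%:M x a.
Proof.
move=> phiP; have [mphi _ _] := phiP.
pose I := ('I_n * 'I_n * option bool)%type; pose V := {ffun I -> R^o}.
pose g x : V := [ffun i => absK (inner (probe R k i) (phi x)) ^+ 2].
pose v : V := [ffun i => sqnorm (probe R k i)].
have int_g i : mu.-integrable setT (fun x => (g x i)%:E) /\
    (\int[mu]_x (g x i)%:E = (v i)%:E)%E.
  have gE : (fun x => (g x i)%:E) =
      (fun x => (absK (inner (probe R k i) (phi x)) ^+ 2)%:E).
    by apply/funext => x; rewrite ffunE.
  rewrite gE ffunE parseval_integral//; split=> //; apply/integrableP.
  split; first exact: measurable_inner_sqr.
  under eq_integral do rewrite gee0_abs ?lee_fin ?sqr_ge0//.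
  by rewrite parseval_integral// ltry.
pose e i : V := [ffun j => (j == i)%:R].
have eE (u : V) : u = \sum_i u i *: e i.
  apply/ffunP => j; rewrite sum_ffunE (bigD1 j)//= !ffunE eqxx.
  rewrite [_ *: _]mulr1 big1 ?addr0// => i /negPf ij.
  by rewrite !ffunE eq_sym ij [LHS]mulr0.
have [|m [a [u [a0 ug vE]]]] := @weak_integral_in_cone _ _ _ mu V g v.
  move=> l.
  have lE (u : V) : ((l u)%:E = \sum_i (l (e i))%:E * (u i)%:E)%E.
    rewrite {1}[u]eE linear_sum sumEFin; congr EFin; apply: eq_bigr => i _.
    by rewrite linearZ/= mulrC.
  have -> : (fun x => (l (g x))%:E) =
      (fun x => \sum_i (l (e i))%:E * (g x i)%:E)%E.
    by apply/funext => x; exact: lE.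
  have int_lg i : mu.-integrable setT (fun x => (l (e i))%:E * (g x i)%:E)%E.
    by apply: integrableZl => //; case: (int_g i).
  split; first exact: integrable_sum.
  rewrite integral_sum// lE; apply: eq_bigr => i _.
  by rewrite integralZl//; case: (int_g i) => // _ ->.
have /choice[x gx] : forall j, exists x, g x = u j.
  by move=> j; have [x _ <-] := ug j; exists x.
exists m, x, a; split=> //; apply: resolution_of_tight => i.
have /ffunP/(_ i) := vE; rewrite ffunE => ->.
by rewrite sum_ffunE; apply: eq_bigr => j _; rewrite -gx !ffunE.
Qed.

Lemma discrete_frame_integral N (x : 'I_N -> T) w phi f :
  borel_measurable phi ->
  (\int[discrete_measure x w]_y (absK (inner f (phi y)) ^+ 2)%:E =
   (\sum_j (w j)%:num * absK (inner f (phi (x j))) ^+ 2)%:E)%E.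
Proof.
move=> mphi; rewrite integral_discrete_measure ?sumEFin//.
  exact: measurable_inner_sqr.
by move=> y; rewrite lee_fin sqr_ge0.
Qed.

Lemma discrete_parsevalP N (x : 'I_N -> T) (w : 'I_N -> {posnum R}) phi :
  borel_measurable phi ->
  parseval_frame (discrete_measure x w) phi <->
  1%:M = \sum_j realK k (w j)%:num *: rank_one (phi (x j)).
Proof.
move=> mphi; split=> [phiP|E].
  apply: resolution_of_tight => i; apply: EFin_inj.
  by rewrite -discrete_frame_integral// parseval_integral.
split=> // [|f]; first by rewrite ltr01 lexx.
by rewrite discrete_frame_integral// (tight_of_resolution f E) mul1r lexx.
Qed.

End Measure.

Lemma discrete_borel_measurable Omega (x0 : Omega) (phi : Omega -> vec) :
  borel_measurable (phi : measurable_space x0 [set: set Omega] -> vec).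
Proof. by move=> _ A _; apply: sub_sigma_algebra. Qed.

Lemma discrete_L2 Omega (x0 : Omega) N (x : 'I_N -> Omega)
    (w : 'I_N -> {posnum R}) (phi : Omega -> vec) :
  in_L2 (@discrete_measure _ (measurable_space x0 [set: set Omega]) R N x w) phi.
Proof.
split; first exact: discrete_borel_measurable.
rewrite integral_discrete_measure; first by rewrite sumEFin ltry.
  by move=> _ A _; apply: sub_sigma_algebra.
by move=> y; rewrite lee_fin sumr_ge0// => i _; exact: sqr_ge0.
Qed.

Lemma cone_rank_oneP Omega (phi : Omega -> vec) A :
  cone (rank_one_family phi) A <->
  exists m (x : 'I_m -> Omega) a, nonneg_rep (rank_one \o phi) A x a.
Proof.
split=> [[m [a [u [a0 uF ->]]]]|[m [x [a [a0 ->]]]]].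
  have /choice[b ab] : forall j, exists t, 0 <= t /\ a j = realK k t.
    by move=> j; have [t t0 ->] := ge0_realK (a0 j); exists t.
  have /choice[x xu] : forall j, exists x, rank_one (phi x) = u j.
    by move=> j; have [x _ <-] := uF j; exists x.
  exists m, x, b; split=> [j|]; first by case: (ab j).
  by apply: eq_bigr => j _; rewrite /= xu; case: (ab j) => _ ->.
exists m, (fun j => realK k (a j)), (fun j => rank_one (phi (x j))); split=> //.
  by move=> j; rewrite -(rmorph0 (@realK R k)) ler_realK.
by move=> j; exists (x j).
Qed.

(** This yields both the measure and the bound on the number of its atoms:
    every nonnegative decomposition of the identity can be shortened. *)
Lemma nonneg_rep_discrete_parseval Omega (x0 : Omega) (phi : Omega -> vec) :
  (exists m (x : 'I_m -> Omega) a, nonneg_rep (rank_one \o phi) 1%:M x a) ->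
  exists N, (N <= \dim (lin (rank_one_family phi)))%N /\
  exists (x : 'I_N -> Omega) (w : 'I_N -> {posnum R}),
    parseval_frame
      (@discrete_measure _ (measurable_space x0 [set: set Omega]) R N x w) phi.
Proof.
move=> /conic_caratheodory[x|N [leN [x [a [a0 E]]]]]; first exact: rank_one_herm.
exists N; split=> //; exists x, (fun j => PosNum (a0 j)).
by apply/discrete_parsevalP; first exact: discrete_borel_measurable.
Qed.

End ParsevalFrames.

Theorem theorem6p8 (R : realType) (k : scalars) (n : nat) (n_gt0 : (0 < n)%N)
    (Omega : Type) (phi : Omega -> 'cV[RorC R k]_n) :
  [<-> cone (rank_one_family phi) 1%:M;
       exists (x0 : Omega) (S : set (set Omega)),
         sigma_algebra [set: Omega] S /\
         exists mu : {measure set (measurable_space x0 S) -> \bar R},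
           in_L2 mu phi /\ parseval_frame mu phi;
       exists N : nat, (N <= \dim (lin (rank_one_family phi)))%N /\
       exists (x : 'I_N -> Omega) (w : 'I_N -> {posnum R}) (x0 : Omega),
         parseval_frame
           (@discrete_measure _ (measurable_space x0 [set: set Omega]) R N x w)
           phi].
Proof.
tfae.
- move=> /cone_rank_oneP rep.
  (* The identity matrix is not zero, so its decomposition has a term. *)
  have [x0] : exists x0 : Omega, True.
    have [[|m] [x [a [_]]]] := rep; last by exists (x ord0).
    rewrite big_ord0 => /matrixP/(_ (Ordinal n_gt0) (Ordinal n_gt0)).
    by rewrite !mxE eqxx => /eqP; rewrite oner_eq0.
  move=> _; have [N [_ [x [w phiP]]]] := nonneg_rep_discrete_parseval x0 rep.
  exists x0, setT; split; first by split=> *; exact: I.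
  exists (@discrete_measure _ (measurable_space x0 [set: set Omega]) R N x w).
  by split; [exact: discrete_L2|exact: phiP].
- move=> [x0 [S [_ [mu [_ /parseval_nonneg_rep rep]]]]].
  have [N [leN [x [w phiP]]]] := nonneg_rep_discrete_parseval x0 rep.
  by exists N; split=> //; exists x, w, x0.
- move=> [N [_ [x [w [x0 phiP]]]]]; apply/cone_rank_oneP.
  exists N, x, (fun j => (w j)%:num); split=> //.
  have [frame_id _] := @discrete_parsevalP R k n _
    (measurable_space x0 [set: set Omega]) N x w phi
    (@discrete_borel_measurable R k n Omega x0 phi).
  exact: frame_id phiP.
Qed.
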